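(* Let $(T,\mathcal{G})$ be a Hausdorff topological space, let $M\subset\mathfrak{RM}_b(T,\mathcal{G})_+$ be a non-empty set of positive bounded Radon measures, and let $\operatorname{cl}M$ be the closure of $M$ in $\mathfrak{RM}_b(T,\mathcal{G})$ with respect to the weak topology $\mathcal{G}_w(\mathfrak{RM}_b(T,\mathcal{G}),S(T,\mathcal{G}))$. Then the following are equivalent: (1) $\operatorname{cl}M$ is compact in the topology induced on it by $\mathcal{G}_w(\mathfrak{RM}_b(T,\mathcal{G}),S(T,\mathcal{G}))$; (2) $M$ has both of the following properties: $(\alpha^{\zeta})$ for every $G\in\mathcal{G}$ and every $\varepsilon>0$ there exists a compact set $C\subset G$ such that $\mu(G\setminus C)<\varepsilon$ for every $\mu\in M$; $(\beta)$ $\sup\{\mu(T)\mid\mu\in M\}<\infty$.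
   Context: $\mathcal{G}$ is the family of open subsets of $T$, and $\mathcal{B}$ is the Borel $\sigma$-algebra. A bounded (signed, real-valued, countably additive) measure $\mu:\mathcal{B}\to\mathbb{R}$ is a bounded Radon measure if for every $B\in\mathcal{B}$ and every $\varepsilon>0$ there is a compact $C\subset B$ with $|\mu B-\mu C|<\varepsilon$. $\mathfrak{RM}_b(T,\mathcal{G})$ is the linear space of all bounded Radon measures, and $\mathfrak{RM}_b(T,\mathcal{G})_+$ is its subset of positive measures. A function $f:T\to\mathbb{R}$ is symmetrizable if for every $\varepsilon>0$ there is a finite cover $(K_i)_{i\in I}$ of $T$ by sets of the form $K_i=G_i\cap F_i$ with $G_i$ open and $F_i$ closed such that $\sup\{|f(s)-f(t)|\mid s,t\in K_i\}<\varepsilon$ for every $i\in I$. $S(T,\mathcal{G})$ is the linear space of all symmetrizable functions on $T$; every such function is bounded and integrable with respect to every bounded Radon measure, where $\int f\,d\mu=\int f\,d\mu_+-\int f\,d(-\mu_-)$ with $\mu_+=\mu\vee 0$, $\mu_-=\mu\wedge 0$. The weak topology $\mathcal{G}_w(\mathfrak{RM}_b(T,\mathcal{G}),S(T,\mathcal{G}))$ is the topology on $\mathfrak{RM}_b(T,\mathcal{G})$ generated by the seminorms $\mu\mapsto|\int f\,d\mu|$, $f\in S(T,\mathcal{G})$: a neighbourhood base at $\mu$ consists of the sets $\{\nu\mid|\int f_k\,d\nu-\int f_k\,d\mu|<\varepsilon\ \text{for all }k\}$ for finite families $(f_k)$ in $S(T,\mathcal{G})$ and $\varepsilon>0$. Compact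 means: Hausdorff and every open cover has a finite subcover. *)

(* Defs.v *)
From HB Require Import structures.
From mathcomp Require Import all_boot all_order all_algebra.
From mathcomp Require Import all_classical all_reals all_analysis.

Set Implicit Arguments.
Unset Strict Implicit.
Unset Printing Implicit Defensive.

Import Order.TTheory GRing.Theory Num.Theory.
Import numFieldNormedType.Exports.

Local Open Scope classical_set_scope.
Local Open Scope ring_scope.

Notation borel_type T := (g_sigma_algebraType (@open T)).

(* A charge is a total function on sets, constrained only on measurable ones;
   fixing the value 0 on the others makes two bounded Radon measures equal as
   soon as they agree on the Borel sets (without it the weak topology could not
   be Hausdorff). The compact set C need not be required to be Borel: it is
   closed whenever T is Hausdorff. *)
Record radon_measure (R : realType) (T : ptopologicalType) := RadonMeasure {
  radon_charge :> {charge set (borel_type T) -> \bar R} ;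
  radon_charge_out : forall B : set (borel_type T),
    ~ measurable B -> radon_charge B = 0%E ;
  radon_inner : forall (B : set (borel_type T)) (e : R),
    measurable B -> 0 < e ->
    exists C : set T, [/\ compact C, C `<=` B &
      (`| radon_charge B - radon_charge C | < e%:E)%E] }.

Definition radon_positive (R : realType) (T : ptopologicalType)
    (mu : radon_measure R T) :=
  forall B : set (borel_type T), measurable B -> (0 <= mu B)%E.

(* The supremum is taken in \bar R, so that it is -oo on an empty K i and
   +oo when f is unbounded on K i. *)
Definition symmetrizable (R : realType) (T : topologicalType) (f : T -> R) :=
  forall e : R, 0 < e ->
  exists (n : nat) (K : 'I_n -> set T),
    [/\ forall i, exists G F, [/\ open G, closed F & K i = G `&` F],
        \bigcup_(i in [set: 'I_n]) K i = [set: T] &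
        forall i, (ereal_sup [set (`| f s - f t |)%:E | s in K i & t in K i]
                   < e%:E)%E].

Section Jordan.
Context d (X : measurableType d) (R : realType).
Implicit Type mu : {charge set X -> \bar R}.

Lemma hahn_pair_ex mu :
  exists PN : set X * set X, hahn_decomposition mu PN.1 PN.2.
Proof. by have [P [N PN]] := Hahn_decomposition mu; exists (P, N). Qed.

Definition hahn_pair mu := cid (hahn_pair_ex mu).

(* mu \/ 0 and - (mu /\ 0); they do not depend on the Hahn decomposition. *)
Definition charge_pos mu : {finite_measure set X -> \bar R} :=
  jordan_pos (projT2 (hahn_pair mu)).

Definition charge_neg mu : {finite_measure set X -> \bar R} :=
  jordan_neg (projT2 (hahn_pair mu)).

Lemma charge_pos_lub mu :
  (forall B, measurable B -> (mu B <= charge_pos mu B)%E) /\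
  forall nu : {measure set X -> \bar R},
    (forall B, measurable B -> (mu B <= nu B)%E) ->
    forall B, measurable B -> (charge_pos mu B <= nu B)%E.
Proof.
have [[mP posP] [mN negN] PNT PN0] := projT2 (hahn_pair mu).
have posE B : measurable B ->
    charge_pos mu B = mu (B `&` (projT1 (hahn_pair mu)).1).
  by move=> mB; rewrite /= jordan_posE cjordan_posE /crestr0 mem_set.
split=> [B mB|nu munu B mB]; rewrite posE//.
  rewrite (charge_partition mu mB mP mN)// geeDl//.
  by apply: negN; [exact: measurableI|exact: subIsetr].
apply: (le_trans (munu _ (measurableI _ _ mB mP))).
by apply: le_measure; rewrite ?inE//; exact: measurableI.
Qed.

Lemma charge_posBneg mu B : measurable B ->
  mu B = (charge_pos mu B - charge_neg mu B)%E.
Proof.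
by move=> mB; rewrite {1}(jordan_decomp (projT2 (hahn_pair mu)) mB)
  /cadd/= cscaleN1.
Qed.

Definition charge_integral mu (f : X -> R) : R :=
  \int[charge_pos mu]_x f x - \int[charge_neg mu]_x f x.

End Jordan.

Section WeakTopology.
Context (R : realType) (T : ptopologicalType).
Local Notation RMb := (radon_measure R T).

HB.instance Definition _ := gen_eqMixin RMb.
HB.instance Definition _ := gen_choiceMixin RMb.

Definition weak_ball (mu : RMb) n (f : 'I_n -> T -> R) (e : R) : set RMb :=
  [set nu : RMb | forall k,
    `| charge_integral nu (f k) - charge_integral mu (f k) | < e].

Definition weak_nbhs (mu : RMb) : set_system RMb :=
  [set A | exists n (f : 'I_n -> T -> R) (e : R),
    [/\ forall k, symmetrizable (f k), 0 < e & weak_ball mu f e `<=` A]].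

HB.instance Definition _ := hasNbhs.Build RMb weak_nbhs.

Lemma weak_nbhs_filter (mu : RMb) : ProperFilter (nbhs mu).
Proof.
apply: Build_ProperFilter_ex => [A [n [f [e [_ e0 fA]]]]|].
  by exists mu; apply: fA => k; rewrite subrr normr0.
split=> [|A B [n [f [e [sf e0 fA]]]] [m [g [r [sg r0 gB]]]]|A B AB].
- exists 0%N, (fun=> cst 0), 1; split=> //; by case.
- exists (n + m)%N,
    (fun k => match fintype.split k with inl i => f i | inr j => g j end),
    (Num.min e r); split; last 1 first.
  + move=> nu nuP; split.
      apply: fA => k; have := nuP (unsplit (inl k)).
      by rewrite unsplitK lt_min => /andP[].
    apply: gB => k; have := nuP (unsplit (inr k)).
    by rewrite unsplitK lt_min => /andP[].
  + by move=> k; case: (fintype.split k).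
  + by rewrite lt_min e0.
- move=> [n [f [e [sf e0 fA]]]]; exists n, f, e; split=> //.
  exact: subset_trans fA AB.
Qed.

Lemma weak_nbhs_singleton (mu : RMb) (A : set RMb) : nbhs mu A -> A mu.
Proof.
by move=> [n [f [e [_ e0 fA]]]]; apply: fA => k; rewrite subrr normr0.
Qed.

Lemma weak_nbhs_nbhs (mu : RMb) (A : set RMb) :
  nbhs mu A -> nbhs mu (nbhs^~ A).
Proof.
move=> [n [f [e [sf e0 fA]]]]; exists n, f, e; split=> // nu nuP.
pose D k := `|charge_integral nu (f k) - charge_integral mu (f k)|.
exists n, f, (\big[Num.min/e]_k (e - D k)); split=> //.
  by apply/bigmin_gtP; split=> // k _; rewrite subr_gt0; exact: nuP.
move=> rho rhoP; apply: fA => k.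
have /lt_le_trans := rhoP k.
move=> /(_ (e - D k)); rewrite bigmin_le_cond// => /(_ isT).
rewrite ltrBrDr; apply: le_lt_trans.
by rewrite -[X in `|X| <= _](subrKA (charge_integral nu (f k))) ler_normD.
Qed.

HB.instance Definition _ := Nbhs_isNbhsTopological.Build RMb
  weak_nbhs_filter weak_nbhs_singleton weak_nbhs_nbhs.

End WeakTopology.

(* Main.v *)
(* On positive bounded Radon measures the weak topology is that of convergence
   on open (equivalently, locally closed) sets, since symmetrizable functions
   are uniform limits of combinations of indicators of such sets.

   If cl M is compact, cover it, for a given open G, by the open sets
   {mu | mu (G \ C) < e} with C ranging over the compact subsets of G; this
   family is directed, so a single C works for all of M.

   Conversely, (beta) lets mu B converge to some l B along any ultrafilter on
   cl M, for every Borel set B, and l is finitely additive; by (alpha^zeta) each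
   open set is approximated in l-content by compact subsets. The Borel sets
   approximable from inside by a compact set and whose complement is too form a
   sigma-algebra, so l is inner regular on all Borel sets and this compactness
   forces it to be sigma-additive: l is a Radon measure, and the limit of the
   ultrafilter. *)
Require Import Defs.
From HB Require Import structures.
From mathcomp Require Import all_boot all_order all_algebra.
From mathcomp Require Import all_classical all_reals all_analysis.
From mathcomp Require Import measurable_realfun.
From mathcomp Require Import ring lra.
Import Order.TTheory GRing.Theory Num.Theory.
Import numFieldNormedType.Exports.
Local Open Scope classical_set_scope.
Local Open Scope ring_scope.

Set Implicit Arguments.
Unset Strict Implicit.
Unset Printing Implicit Defensive.

Local Notation borel T := (@measurable _ (borel_type T)).

(** * Borel measurability of topologically simple sets *)

Section Borel.
Context (T : ptopologicalType).
Implicit Types B : set T.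

Lemma open_borel B : open B -> borel T B.
Proof. by move=> oB; exact: (@sub_sigma_algebra T setT (@open T) B oB). Qed.

Lemma closed_borel B : closed B -> borel T B.
Proof.
move=> cB; rewrite -(setCK B).
by apply: (@measurableC _ (borel_type T)); apply: open_borel; rewrite openC.
Qed.

Lemma compact_borel B : hausdorff_space T -> compact B -> borel T B.
Proof. by move=> hT cB; apply: closed_borel; exact: compact_closed. Qed.

End Borel.

(** * From tight finitely additive contents to Radon measures *)

Section Content.
Context (R : realType) (T : ptopologicalType) (hT : hausdorff_space T).
Implicit Types (A B : set T) (F : (set T)^nat) (e : R).
Variable l : set T -> R.
Hypothesis l_ge0 : forall B : set T, borel T B -> 0 <= l B.
Hypothesis l_add : forall A B : set T,
  borel T A -> borel T B -> A `&` B = set0 -> l (A `|` B) = l A + l B.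
Hypothesis l_tight : forall (G : set T) (e : R), open G -> 0 < e ->
  exists C, [/\ compact C, C `<=` G & l (G `\` C) <= e].

Let mT : borel T [set: T]. Proof. exact: measurableT. Qed.
Let mU (A B : set T) : borel T A -> borel T B -> borel T (A `|` B).
Proof. exact: measurableU. Qed.
Let mD (A B : set T) : borel T A -> borel T B -> borel T (A `\` B).
Proof. exact: measurableD. Qed.
Let mC (A : set T) : borel T A -> borel T (~` A).
Proof. exact: measurableC. Qed.
Let mbigU n (F : (set T)^nat) : (forall i, borel T (F i)) ->
  borel T (\big[setU/set0]_(i < n) F i).
Proof. by move=> mF; apply: (@bigsetU_measurable _ (borel_type T)). Qed.

Lemma content_set0 : l set0 = 0.
Proof.
have := l_add (@measurable0 _ (borel_type T)) (@measurable0 _ (borel_type T)).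
by rewrite setU0 setI0 => /(_ erefl); lra.
Qed.

Lemma contentDsub A B : borel T A -> borel T B -> A `<=` B ->
  l B = l A + l (B `\` A).
Proof.
move=> mA mB AB; rewrite -l_add//; first by rewrite setDUK.
- exact: mD.
- by rewrite setDIK.
Qed.

Lemma content_le A B : borel T A -> borel T B -> A `<=` B -> l A <= l B.
Proof.
move=> mA mB AB; rewrite (contentDsub mA mB AB).
by rewrite lerDl; apply: l_ge0; apply: mD.
Qed.

Lemma contentU_le A B : borel T A -> borel T B -> l (A `|` B) <= l A + l B.
Proof.
move=> mA mB; rewrite (contentDsub mA (mU mA mB))//.
rewrite lerD2l; apply: content_le => //; first by apply: mD => //; exact: mU.
by move=> x [[]].
Qed.

Lemma content_bigsetU_le (F : (set T)^nat) n : (forall i, borel T (F i)) ->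
  l (\big[setU/set0]_(i < n) F i) <= \sum_(i < n) l (F i).
Proof.
move=> mF; elim: n => [|n IHn]; first by rewrite !big_ord0 content_set0.
rewrite !big_ord_recr/=; apply: (le_trans (contentU_le _ _)) => //.
  exact: mbigU.
by rewrite lerD2r.
Qed.

Lemma content_bigsetU (F : (set T)^nat) n : (forall i, borel T (F i)) ->
  trivIset setT F -> l (\big[setU/set0]_(i < n) F i) = \sum_(i < n) l (F i).
Proof.
move=> mF tF; elim: n => [|n IHn]; first by rewrite !big_ord0 content_set0.
rewrite !big_ord_recr/= l_add ?IHn//; first exact: mbigU.
by apply: (@trivIset_bigsetUI _ predT F) => //; exact: sub_trivIset tF.
Qed.

(** Approximating [B] and its complement together makes the property invariant under complements.
    Since [C'] misses [B], the residual set contains [B \ C], so inner regularity of [B] follows. *)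
Definition content_regular B := forall e, 0 < e -> exists C C',
  [/\ compact C, compact C', C `<=` B, C' `<=` ~` B & l (~` (C `|` C')) <= e].

Let cpt_borel C : compact C -> borel T C.
Proof. exact: compact_borel. Qed.

(** Tightness of [G] gives [C]; for the closed complement, cut it down by a compact [K] that nearly
    exhausts the whole space. What is missed lies in [G \ C] or outside [K]. *)
Lemma open_content_regular G : open G -> content_regular G.
Proof.
move=> oG e e0; have e20 : 0 < e / 2 by rewrite divr_gt0.
have [C [cC CG lC]] := l_tight oG e20.
have [K [cK _ lK]] := l_tight openT e20.
exists C, (K `&` ~` G); split => //.
- by apply: compact_closedI => //; rewrite closedC.
- have -> : e = e / 2 + e / 2 by field.
  apply: le_trans (lerD lC lK).
  have mC' := cpt_borel cC; have mK := cpt_borel cK; have mG := open_borel oG.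
  apply: le_trans (contentU_le (mD mG mC') (mD mT mK)).
  apply: content_le.
  + apply: mC; apply: mU => //.
    by apply: (@measurableI _ (borel_type T)) => //; exact: mC.
  + by apply: mU; exact: mD.
  + move=> x /= /not_orP[Cx /not_andP KGx].
    have [Gx|Gx] := pselect (G x); [by left|right; split => //].
    by case: KGx => // /contrapT.
Qed.

Lemma content_regularC B : content_regular B -> content_regular (~` B).
Proof.
move=> rB e /rB [C [C' [cC cC' CB CB' lC]]].
by exists C', C; split => //; rewrite ?setCK// setUC.
Qed.

(* The complement of the compact set [\bigcap_n C' n] is open, hence nearly
   exhausted by a compact set, which finitely many of the [~` C' n] cover: this
   is where the tightness of [l] replaces sigma-additivity. *)
Lemma bigcup_content_regular (B : (set T)^nat) e :
  (forall n, content_regular (B n)) -> 0 < e ->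
  exists (C : (set T)^nat) C' N, [/\ forall n, compact (C n),
    forall n, C n `<=` B n, compact C', C' `<=` ~` (\bigcup_n B n) &
    l (~` (\big[setU/set0]_(i < N) C i `|` C')) <= e].
Proof.
(* The errors [d n] sum to less than [e / 2]; the other half is spent on the compact set [K]
   below. *)
move=> rB e0; pose d n := e / 2 / (2 ^ n.+1)%:R.
have d0 n : 0 < d n by rewrite /d !divr_gt0// ltr0n expn_gt0.
have /choice[CC CCP] : forall n, exists CC : set T * set T,
    [/\ compact CC.1, compact CC.2, CC.1 `<=` B n, CC.2 `<=` ~` (B n) &
     l (~` (CC.1 `|` CC.2)) <= d n].
  by move=> n; have [C [C' H]] := rB n _ (d0 n); exists (C, C').
pose C n := (CC n).1; pose C' n := (CC n).2.
have cC n : compact (C n) by have [] := CCP n.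
have cC' n : compact (C' n) by have [] := CCP n.
have mCn n : borel T (C n) by exact: cpt_borel.
have mC'n n : borel T (C' n) by exact: cpt_borel.
pose C'' := \bigcap_n C' n.
have clC'' : closed C''.
  by apply: closed_bigI => n _; exact: compact_closed.
have cC'' : compact C''.
  by apply: (subclosed_compact clC'' (cC' 0%N)) => x /(_ 0%N I).
have [K [cK KC'' lK]] : exists K, [/\ compact K, K `<=` ~` C'' &
    l (~` C'' `\` K) <= e / 2].
  by apply: l_tight; [rewrite openC|rewrite divr_gt0].
have [N KN] : exists N, K `<=` \big[setU/set0]_(i < N) ~` (C' i).
  move: cK; rewrite compact_cover => /(_ nat setT (fun n => ~` (C' n))).
  case=> [n _|x Kx|D _ KD].
  - by rewrite openC; exact: compact_closed.
  - have /KC'' := Kx; rewrite /C'' setC_bigcap => -[n _ C'nx].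
    by exists n.
  (* One more than the largest index of the finite subcover, because the union runs over [i < N]. *)
  - exists (\max_(i <- finmap.enum_fset D) i).+1 => x /KD[i /= iD C'ix].
    rewrite -(bigcup_mkord _ (fun i => ~` C' i)); exists i => //=.
    by rewrite ltnS; apply: leq_bigmax_seq.
exists C, C'', N; split=> //.
- by move=> n; have [] := CCP n.
- by move=> x C''x [n _ Bnx]; have [_ _ _ /(_ x (C''x n I))] := CCP n.
have mK := cpt_borel cK; have mC'' := cpt_borel cC''.
have -> : e = e / 2 + e / 2 by field.
have le2 : \sum_(i < N) l (~` (C i `|` C' i)) <= e / 2.
  apply: (@le_trans _ _ (\sum_(i < N) d i)).
    by apply: ler_sum => i _; have [] := CCP i.
  (* Closed form of the geometric sum, proved by induction on [N]. *)
  suff -> : \sum_(i < N) d i = e / 2 - e / 2 / (2 ^ N)%:R.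
    by rewrite gerBl !divr_ge0// ltW.
  elim: {KN} N => [|n IHn]; first by rewrite big_ord0 expn0; field.
  rewrite big_ord_recr/= IHn /d expnS natrM; field.
  by rewrite pnatr_eq0 expn_eq0.
apply: le_trans (lerD lK le2).
have mCC i : borel T (~` (C i `|` C' i)) by apply: mC; exact: mU.
apply: le_trans (lerD (lexx _) (content_bigsetU_le N mCC)).
have mB1 : borel T (\big[setU/set0]_(i < N) C i) by exact: mbigU.
have mB2 := mbigU N mCC.
apply: le_trans (contentU_le (mD (mC mC'') mK) mB2).
apply: content_le; [by apply: mC; exact: mU|exact: mU (mD (mC mC'') mK) mB2|].
move=> x /= /not_orP[nCx nC''x].
(* A residual point outside [K] is charged to the tightness error; one inside [K] escapes some
   [C' i] with [i < N], and it also misses [C i], so it is charged to the error of [B i]. *)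
have [Kx|nKx] := pselect (K x); [right|by left].
have := KN _ Kx; rewrite -(bigcup_mkord _ (fun i => ~` C' i)).
move=> -[i /= iN C'ix].
rewrite -(bigcup_mkord _ (fun i => ~` (C i `|` C' i))).
exists i => //= -[Cix|//]; apply: nCx.
by rewrite -bigcup_mkord; exists i.
Qed.

(** The regular sets form a sigma-algebra containing the open sets; countable unions are the only
    hard closure property. *)
Lemma borel_content_regular B : borel T B -> content_regular B.
Proof.
suff sub : <<s @open T >> `<=` content_regular by exact: sub.
apply: smallest_sub; last first.
  exact: open_content_regular.
split=> [|A rA|F rF].
- by apply: open_content_regular; exact: open0.
- by rewrite setTD; exact: content_regularC.
move=> e e0.
have [C [C' [N [cC CF cC' C'F lC]]]] := bigcup_content_regular rF e0.
exists (\big[setU/set0]_(i < N) C i), C'; split => //.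
- exact: bigsetU_compact.
- by rewrite -bigcup_mkord => x [i _ Cix]; exists i => //; exact: CF.
Qed.

(** Finitely many compact sets [C i] inside the [F i] already exhaust the whole union up to [e];
    once [n] is at least [N], the tail of the union lies in the residual set. *)
Lemma content_sigma_additive (F : (set T)^nat) : (forall n, borel T (F n)) ->
  trivIset setT F ->
  \sum_(0 <= i < n) l (F i) @[n --> \oo] --> l (\bigcup_n F n).
Proof.
move=> mF tF; apply/cvgrPdist_le => e e0.
have [C [C' [N [cC CF cC' C'F lC]]]] :=
  bigcup_content_regular (fun n => borel_content_regular (mF n)) e0.
have mCn n := cpt_borel (cC n).
have mC' := cpt_borel cC'.
have mUF : borel T (\bigcup_n F n).
  exact: (@bigcupT_measurable _ (borel_type T)).
near=> n; rewrite big_mkord -content_bigsetU//.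
have mn : borel T (\big[setU/set0]_(i < n) F i) by exact: mbigU.
have nsub : \big[setU/set0]_(i < n) F i `<=` \bigcup_n F n.
  by rewrite -bigcup_mkord => x [i _ ?]; exists i.
rewrite (contentDsub mn mUF nsub) [X in X - _]addrC addrK.
rewrite ger0_norm; last by apply: l_ge0; exact: mD.
apply: le_trans lC; apply: content_le.
- exact: mD.
- by apply: mC; apply: mU => //; exact: mbigU.
move=> x [UFx nFx] [|C'x]; last exact: C'F C'x UFx.
rewrite -bigcup_mkord => -[i /= iN /CF Fix].
apply: nFx; rewrite -bigcup_mkord; exists i => //=.
by apply: leq_trans iN _; near: n; exact: nbhs_infty_ge.
Unshelve. all: by end_near. Qed.

Lemma content_radon_measure : exists mu : radon_measure R T,
  forall B, borel T B -> mu B = (l B)%:E.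
Proof.
(* The value [0] off the Borel sets is what [radon_charge_out] demands. *)
pose nu (B : set (borel_type T)) : \bar R :=
  if pselect (measurable B) then (l B)%:E else 0%E.
have nuE B : borel T B -> nu B = (l B)%:E by rewrite /nu; case: pselect.
have nu0 : nu set0 = 0%E.
  by rewrite nuE ?content_set0//; exact: (@measurable0 _ (borel_type T)).
have nufin B : borel T B -> nu B \is a fin_num by move=> /nuE ->.
have nusig : semi_sigma_additive nu.
  move=> F mF tF mUF; rewrite nuE//.
  have -> : (fun n => \sum_(0 <= i < n) nu (F i))%E =
      (fun n => (\sum_(0 <= i < n) l (F i))%:E).
    by apply/funext => n; rewrite -sumEFin; apply: eq_bigr => i _; rewrite nuE.
  apply: cvg_EFin; first exact: nearW.
  exact: content_sigma_additive.
pose mix := isCharge.Build _ (borel_type T) R nu nu0 nufin nusig.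
pose ch : {charge set (borel_type T) -> \bar R} := HB.pack nu mix.
have chout B : ~ borel T B -> ch B = 0%E.
  by move=> nB; rewrite /ch/= /nu; case: pselect.
have inner (B : set (borel_type T)) (e : R) : measurable B -> 0 < e ->
    exists C : set T, [/\ compact C, C `<=` B & (`| ch B - ch C | < e%:E)%E].
  move=> mB e0; have e20 : 0 < e / 2 by rewrite divr_gt0.
  have [C [C' [cC cC' CB CB' lC]]] := borel_content_regular mB e20.
  have mCC := cpt_borel cC; have mCC' := cpt_borel cC'.
  exists C; split => //; rewrite /ch/= !nuE// (contentDsub mCC mB CB).
  rewrite -EFinB lte_fin addrC addKr ger0_norm; last by apply: l_ge0; exact: mD.
  apply: (@le_lt_trans _ _ (e / 2)); last lra.
  apply: le_trans lC; apply: content_le; [exact: mD|by apply: mC; exact: mU|].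
  by move=> x [Bx nCx] [//|/CB'].
by exists (RadonMeasure chout inner) => B mB; exact: nuE.
Qed.

End Content.

(** * Uniform approximation of symmetrizable functions by Borel step functions *)

Section StepFunctions.
Context (R : realType) (T : ptopologicalType).
Implicit Types (A : set T) (f g : T -> R).

Lemma locally_closed_symmetrizable (G F : set T) : open G -> closed F ->
  symmetrizable (\1_(G `&` F) : T -> R).
Proof.
move=> oG cF e e0.
(* The last two pieces may overlap, but the indicator is constant on each of the three. *)
exists 3%N, (fun i => nth set0 [:: G `&` F; setT `&` ~` G; ~` F `&` setT] i).
split=> [[[|[|[|//]]] ?]/=||i].
- by exists G, F.
- by exists setT, (~` G); split; [exact: openT|rewrite closedC|].
- by exists (~` F), setT; split; [rewrite openC|exact: closedT|].
- apply/seteqP; split=> // x _.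
  have [Gx|nGx] := pselect (G x); last by exists (inord 1); rewrite //= inordK.
  have [Fx|nFx] := pselect (F x); last by exists (inord 2); rewrite //= inordK.
  by exists ord0.
- apply: (@le_lt_trans _ _ 0%E); last by rewrite lte_fin.
  apply: ge_ereal_sup => _ [s Ks [t Kt <-]].
  rewrite lee_fin; suff -> : \1_(G `&` F) s = \1_(G `&` F) t :> R.
    by rewrite subrr normr0.
  case: i Ks Kt => [[|[|[|//]]] ?]/= [? ?] [? ?]; rewrite !indicE.
  + by rewrite !mem_set.
  + by rewrite !memNset// => -[].
  + by rewrite !memNset// => -[].
Qed.

(** The inductive form lets statements linear in the function be proved one indicator at a time. *)
Inductive step_function : (T -> R) -> Prop :=
| step_function0 : step_function (cst 0)
| step_functionD c A g : borel T A -> step_function g ->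
    step_function (fun x => c * \1_A x + g x).

Lemma step_function_restrict g A : borel T A -> step_function g ->
  step_function (fun x => \1_A x * g x).
Proof.
move=> mA; elim=> [|c B h mB sh IH].
  rewrite (_ : (fun _ => _) = cst 0); first exact: step_function0.
  by apply/funext => x /=; rewrite mulr0.
rewrite (_ : (fun _ => _) =
    (fun x => c * \1_(A `&` B) x + (fun y => \1_A y * h y) x)).
  by apply: step_functionD => //; exact: (@measurableI _ (borel_type T)).
by apply/funext => x /=; rewrite indicI/=; ring.
Qed.

(** Induction on the list of pieces. The sets may overlap, so each new piece overrides the function
    built so far, which is kept only on its complement. *)
Lemma step_function_approx (I : eqType) (s : seq I) (K : I -> set T) f (e : R) :
  (forall i, borel T (K i)) ->
  (forall i x y, K i x -> K i y -> `|f x - f y| <= e) ->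
  exists g, step_function g /\
    forall i, i \in s -> forall x, K i x -> `|f x - g x| <= e.
Proof.
move=> mK fK; elim: s => [|i s [g [sg gP]]].
  by exists (cst 0); split => //; exact: step_function0.
have [[y Kiy]|Ki0] := pselect (K i !=set0); last first.
  exists g; split=> // j; rewrite inE => /predU1P[->|/gP//] x Kix.
  by case: Ki0; exists x.
(* On [K i] the value is that of [f] at a sample point [y], within [e] of [f] by the oscillation
   bound. *)
exists (fun x => f y * \1_(K i) x + \1_(~` K i) x * g x); split.
  apply: step_functionD => //; apply: step_function_restrict => //.
  exact: (@measurableC _ (borel_type T)).
move=> j js x Kjx; rewrite !indicE in_setC.
have [Kix|nKix] := boolP (x \in K i).
  by rewrite mulr1 mul0r addr0; apply: (fK i) => //; exact: set_mem.
rewrite mulr0 mul1r add0r; move: js Kjx; rewrite inE => /predU1P[->|js].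
  by move/mem_set; rewrite (negbTE nKix).
exact: gP.
Qed.

Lemma symmetrizable_approx f (e : R) : symmetrizable f -> 0 < e ->
  exists g, step_function g /\ forall x, `|f x - g x| <= e.
Proof.
move=> sf e0; have [n [K [lcK cvK fK]]] := sf _ e0.
have [i|i x y Kix Kiy|g [sg gP]] := @step_function_approx _ (enum 'I_n) K f e.
- have [G [F [oG cF ->]]] := lcK i.
  apply: (@measurableI _ (borel_type T)); first exact: open_borel.
  exact: closed_borel.
- rewrite -lee_fin; apply: le_trans (ltW (fK i)).
  by apply: ereal_sup_ubound; exists x => //; exists y.
- exists g; split=> // x; have : [set: T] x by [].
  by rewrite -cvK => -[i _]; apply: gP; rewrite mem_enum.
Qed.

Definition bounded_borel f :=
  measurable_fun [set: borel_type T] f /\ exists M, forall x, `|f x| <= M.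

Lemma step_function_bounded_borel g : step_function g -> bounded_borel g.
Proof.
elim=> [|c A h mA sh [mh [M hM]]]; split.
- exact: measurable_cst.
- by exists 0 => x; rewrite normr0.
- apply: measurable_funD => //; apply: measurable_funM.
    exact: measurable_cst.
  exact: measurable_indic.
- exists (`|c| + M) => x; apply: le_trans (ler_normD _ _) _.
  apply: lerD => //; rewrite normrM ler_piMr// indicE.
  by case: (_ \in _); rewrite ?normr0 ?normr1.
Qed.

(** A single step function within distance 1 gives boundedness; a sequence within [1 / (n + 1)]
    gives measurability in the limit. *)
Lemma symmetrizable_bounded_borel f : symmetrizable f -> bounded_borel f.
Proof.
move=> sf; split; last first.
  have [g [/step_function_bounded_borel[_ [M gM]] fg]] :=
    symmetrizable_approx sf ltr01.
  exists (1 + M) => x; rewrite -[f x](subrK (g x)).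
  by apply: le_trans (ler_normD _ _) _; exact: lerD.
have /choice[g gP] : forall n, exists g, step_function g /\
    forall x, `|f x - g x| <= n.+1%:R^-1.
  by move=> n; apply: symmetrizable_approx => //; rewrite invr_gt0.
apply: (@measurable_fun_cvg _ (borel_type T) R setT g) => [n|x _].
  by have [/step_function_bounded_borel[]] := gP n.
apply/cvgrPdist_le => e e0; near=> n.
have [_ /(_ x) /le_trans] := gP n; apply; apply/ltW.
by near: n; exact: (near_infty_natSinv_lt (PosNum e0)).
Unshelve. all: by end_near. Qed.

End StepFunctions.

(** * Integration against charges, in particular positive ones *)

Section ChargeIntegral.
Context (R : realType) (T : ptopologicalType).
Implicit Types (A : set T) (f g : T -> R).
Implicit Types mu : {charge set (borel_type T) -> \bar R}.

Lemma bounded_borel_integrable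
    (mu : {finite_measure set (borel_type T) -> \bar R}) f :
  bounded_borel f -> mu.-integrable setT (EFin \o f).
Proof.
move=> [mf [M fM]]; apply: measurable_bounded_integrable => //.
  by rewrite ltey_eq fin_num_measure.
exists M; split; first exact: num_real.
by move=> x Mx y _; apply: le_trans (fM y) (ltW Mx).
Qed.

Lemma charge_integralD mu c A g : borel T A -> bounded_borel g ->
  charge_integral mu (fun x => c * \1_A x + g x) =
    c * fine (mu A) + charge_integral mu g.
Proof.
move=> mA bg.
have intE (m : {finite_measure set (borel_type T) -> \bar R}) :
    \int[m]_x (c * \1_A x + g x) = c * fine (m A) + \int[m]_x g x.
  have i1 : m.-integrable setT (EFin \o (\1_A : _ -> R)).
    exact: integrable_indic.
  rewrite RintegralD//; last 2 first.
  - exact: (integrableZl measurableT c i1).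
  - exact: bounded_borel_integrable.
  by rewrite RintegralZl// /Rintegral integral_indic// setIT.
rewrite /charge_integral !intE (charge_posBneg _ mA) fineB ?fin_num_measure//.
by ring.
Qed.

Lemma charge_integral_indic mu A : borel T A ->
  charge_integral mu \1_A = fine (mu A).
Proof.
move=> mA.
have b0 : bounded_borel (cst 0 : T -> R).
  by apply: step_function_bounded_borel; exact: step_function0.
have := charge_integralD mu 1 mA b0.
rewrite {2}/charge_integral !Rintegral_cst// !mul0r subrr addr0 mul1r => <-.
by congr charge_integral; apply/funext => x; rewrite mul1r addr0.
Qed.

(** The negative Hahn set carries no mass: on its subsets [mu] is both nonnegative and
    nonpositive. *)
Lemma charge_pos_id mu : (forall A, borel T A -> (0 <= mu A)%E) ->
  forall A, borel T A -> charge_pos mu A = mu A.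
Proof.
move=> mu0 A mA.
have [[mP posP] [mN negN] PNT PN0] := projT2 (hahn_pair mu).
have -> : charge_pos mu A = mu (A `&` (projT1 (hahn_pair mu)).1).
  by rewrite /= jordan_posE cjordan_posE /crestr0 mem_set.
rewrite [RHS](charge_partition mu mA mP mN)//.
suff -> : mu (A `&` (projT1 (hahn_pair mu)).2) = 0%E by rewrite adde0.
have mAN := measurableI _ _ mA mN.
by apply/eqP; rewrite eq_le mu0//; rewrite negN.
Qed.

Lemma charge_integral_pos mu f : (forall A, borel T A -> (0 <= mu A)%E) ->
  charge_integral mu f = \int[charge_pos mu]_x f x.
Proof.
move=> mu0; rewrite /charge_integral [X in _ - X](_ : _ = 0) ?subr0//.
rewrite /Rintegral (@eq_measure_integral _ _ _ _ mzero).
  by rewrite integral_measure_zero.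
move=> A mA _; suff : charge_neg mu A = 0%E by [].
have := charge_posBneg mu mA; rewrite -(charge_pos_id mu0 mA).
rewrite -[charge_neg mu A]fineK ?fin_num_measure//.
rewrite -[charge_pos mu A]fineK ?fin_num_measure// -EFinB => -[] rs.
by congr EFin; lra.
Qed.

Lemma charge_integral_dist_le mu f g e :
  (forall A, borel T A -> (0 <= mu A)%E) ->
  bounded_borel f -> bounded_borel g -> (forall x, `|f x - g x| <= e) ->
  `|charge_integral mu f - charge_integral mu g| <= e * fine (mu setT).
Proof.
move=> mu0 bf bg fge; have mT : borel T setT by exact: measurableT.
rewrite !charge_integral_pos// -(charge_pos_id mu0 mT).
have [ifm igm] := (bounded_borel_integrable (charge_pos mu) bf,
  bounded_borel_integrable (charge_pos mu) bg).
have ifg : (charge_pos mu).-integrable setT (EFin \o (fun x => f x - g x)).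
  by apply: integrableB ifm igm.
rewrite -RintegralB//; apply: le_trans (le_normr_Rintegral _ ifg) _ => //.
rewrite -Rintegral_cst//; apply: le_Rintegral => //.
- exact: (integrable_norm ifg).
- apply: bounded_borel_integrable.
  by split; [exact: measurable_cst|exists `|e|].
Qed.

End ChargeIntegral.

(** * General facts on separation, closures, subspaces and ultrafilters *)

Section Topology.
Context (R : realType).

Lemma hausdorff_separating (X : topologicalType) :
  (forall x y : X,
    (forall g : X -> R, continuous g -> g x = g y) -> x = y) ->
  hausdorff_space X.
Proof.
move=> sepX x y xy; apply: sepX => g cg; apply: Rhausdorff => A B Ax By.
by have [z [Az Bz]] := xy _ _ (cg x A Ax) (cg y B By); exists (g z).
Qed.

Lemma closure_le (X : topologicalType) (M : set X) (g : X -> R) c :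
  continuous g -> (forall x, M x -> g x <= c) ->
  forall x, closure M x -> g x <= c.
Proof.
move=> cg Mc x Mx; have : closure [set y | g y <= c] x.
  exact: closure_subset Mx.
rewrite -(closure_id _).1//.
by apply: (@closed_comp _ _ g [set y | y <= c]) => //; exact: closed_le.
Qed.

(** Translates compactness of the subspace into compactness inside the ambient space: one way by the
    continuous inclusion, the other by pulling a cluster point back. *)
Lemma compact_set_type (X : topologicalType) (A : set X) :
  compact [set: set_type A] <-> compact A.
Proof.
split=> [cA|cA F FF _].
  suff <- : [set set_val x | x in [set: set_type A]] = A.
    apply: continuous_compact cA; apply: continuous_subspaceT.
    exact: initial_continuous.
  apply/seteqP; split=> [_ [x _ <-]|x Ax]; first exact: set_valP.
  by exists (exist _ x (mem_set Ax)).
have [|x [Ax Fx]] := cA (set_val @ F) _.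
  by rewrite /fmap/=; apply: filterS filterT => y _; exact: set_valP.
exists (exist _ x (mem_set Ax)); split=> // B C FB [D [[E oE <-]/= Ex] EC].
have [||_ [[y By <-]]] := Fx (set_val @` B) E.
- by apply: (@filterS _ F _ B) => // y By; exists y.
- by apply: open_nbhs_nbhs.
by move=> Ey; exists y; split => //; exact: EC.
Qed.

(** A cluster point of the image filter is already a limit, since an ultrafilter contains the
    preimage of each neighbourhood or its complement. *)
Lemma ultra_fmap_cvg (X : Type) (Y : topologicalType) (F : set_system X)
    (f : X -> Y) (K : set Y) :
  UltraFilter F -> compact K -> F (f @^-1` K) ->
  exists x, K x /\ f y @[y --> F] --> x.
Proof.
move=> FU cK FK; have [x [Kx Fx]] := cK (f @ F) _ FK.
exists x; split=> // U Ux.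
have [//|FU'] := in_ultra_setVsetC (f @^-1` U) FU.
by have [y []] := Fx (~` U) U FU' Ux.
Qed.

End Topology.

(** * Weak continuity, separation and compactness for Radon measures *)

Section RadonMeasures.
Context (R : realType) (T : ptopologicalType) (hT : hausdorff_space T).
Local Notation RMb := (radon_measure R T).
Implicit Types (A B C G : set T) (mu nu : RMb).

Lemma charge_integral_continuous (f : T -> R) : symmetrizable f ->
  continuous (fun mu : RMb => charge_integral mu f).
Proof.
move=> sf mu; apply: (@cvgrPdist_lt _ _ _ (nbhs mu) _ _ _).2 => e e0.
exists 1%N, (fun=> f), e; split=> // nu /(_ ord0) /=.
by rewrite distrC.
Qed.

Lemma locally_closed_continuous G F : open G -> closed F ->
  continuous (fun mu : RMb => fine (mu (G `&` F))).
Proof.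
move=> oG cF.
rewrite (_ : (fun _ => _) =
    (fun mu : RMb => charge_integral mu (\1_(G `&` F) : T -> R))).
  by apply: charge_integral_continuous; exact: locally_closed_symmetrizable.
apply/funext => mu; rewrite charge_integral_indic//.
apply: (@measurableI _ (borel_type T)); first exact: open_borel.
exact: closed_borel.
Qed.

Lemma open_continuous G : open G ->
  continuous (fun mu : RMb => fine (mu G)).
Proof.
by move=> oG; rewrite -(setIT G); apply: locally_closed_continuous.
Qed.

Lemma compact_continuous C : compact C ->
  continuous (fun mu : RMb => fine (mu C)).
Proof.
move=> cC; rewrite -(setTI C); apply: locally_closed_continuous.
  exact: openT.
exact: compact_closed.
Qed.

(** Off the Borel sets both charges vanish, so the set functions coincide; all other fields are
    proofs, identified by proof irrelevance. *)
Lemma radon_measure_ext mu nu : (forall B, borel T B -> mu B = nu B) -> mu = nu.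
Proof.
move=> munu.
have {munu} : radon_charge mu = radon_charge nu :> (set T -> \bar R).
  apply/funext => B; have [mB|nB] := pselect (borel T B); first exact: munu.
  by rewrite !radon_charge_out.
case: mu nu => [[f [[f1] [f2] [f3]]] fo fi] [[g [[g1] [g2] [g3]]] go gi] /= fg.
subst g; rewrite (Prop_irrelevance f1 g1) (Prop_irrelevance f2 g2).
rewrite (Prop_irrelevance f3 g3) in fo fi *.
by congr RadonMeasure; exact: Prop_irrelevance.
Qed.

Lemma fine_radon_ge0 mu : radon_positive mu ->
  forall B, borel T B -> 0 <= fine (mu B).
Proof. by move=> pmu B mB; apply: fine_ge0; exact: pmu. Qed.

Lemma fine_radonD mu A B : borel T A -> borel T B -> A `&` B = set0 ->
  fine (mu (A `|` B)) = fine (mu A) + fine (mu B).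
Proof.
by move=> mA mB AB; rewrite chargeU// fineD// fin_num_measure.
Qed.

Lemma fine_radon_le mu A B : radon_positive mu -> borel T A -> borel T B ->
  A `<=` B -> fine (mu A) <= fine (mu B).
Proof.
move=> pmu; apply: (@content_le _ _ (fun B => fine (mu B))).
- exact: fine_radon_ge0.
- exact: fine_radonD.
Qed.

Lemma fine_radon_inner mu B e : radon_positive mu -> borel T B -> 0 < e ->
  exists C, [/\ compact C, C `<=` B & fine (mu (B `\` C)) < e].
Proof.
move=> pmu mB e0; have [C [cC CB muC]] := radon_inner mu mB e0.
exists C; split=> //; have mC := compact_borel hT cC.
have E := @contentDsub _ _ _ (@fine_radonD mu) _ _ mC mB CB.
move: muC; rewrite -[X in (X - _)%E]fineK ?fin_num_measure//.
rewrite -[X in (_ - X)%E]fineK ?fin_num_measure//.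
rewrite -EFinB abse_EFin lte_fin E addrC addKr.
by apply: le_lt_trans; exact: ler_norm.
Qed.

Lemma radon_positive_eq mu nu : radon_positive mu -> radon_positive nu ->
  (forall C, compact C -> fine (mu C) = fine (nu C)) -> mu = nu.
Proof.
move=> pmu pnu munu; apply: radon_measure_ext => B mB.
(* The hypotheses are symmetric in the two measures, so one inequality suffices; it follows from
   inner regularity of the smaller side. *)
suff le : forall m1 m2 : RMb, radon_positive m1 -> radon_positive m2 ->
    (forall C, compact C -> fine (m1 C) = fine (m2 C)) ->
    fine (m1 B) <= fine (m2 B).
  rewrite -[LHS]fineK ?fin_num_measure// -[RHS]fineK ?fin_num_measure//.
  congr EFin; apply/eqP; rewrite eq_le !le// => C cC.
  by rewrite munu.
move=> {pmu pnu munu mu nu} mu nu pmu pnu munu; apply/ler_addgt0Pr => e e0.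
have [C [cC CB BC]] := fine_radon_inner pmu mB e0.
have mC := compact_borel hT cC.
rewrite (@contentDsub _ _ _ (@fine_radonD mu) _ _ mC mB CB).
by apply: lerD (ltW BC); rewrite munu//; exact: fine_radon_le.
Qed.

(** Evaluation at a compact set is weakly continuous, so nonnegativity there passes to the closure;
    inner regularity would turn a negative value on [B] into one on a compact subset. *)
Lemma closure_radon_positive (M : set RMb) :
  (forall mu, M mu -> radon_positive mu) ->
  forall mu, closure M mu -> radon_positive mu.
Proof.
move=> Mpos mu Mmu B mB; rewrite -[X in (_ <= X)%E]fineK ?fin_num_measure//.
rewrite lee_fin leNgt; apply/negP => muB0.
have e0 : 0 < - fine (mu B) by rewrite oppr_gt0.
have [C [cC CB]] := radon_inner mu mB e0.
have mC := compact_borel hT cC.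
rewrite -[X in (X - _)%E]fineK ?fin_num_measure//.
rewrite -[X in (_ - X)%E]fineK ?fin_num_measure//.
rewrite -EFinB abse_EFin lte_fin ltr_norml => /andP[muC _].
have : - fine (mu C) <= 0.
  apply: (@closure_le _ _ M (fun mu : RMb => - fine (mu C))) => //.
  - by move=> nu; exact: (cvgN (compact_continuous cC (x := nu))).
  - move=> nu Mnu; rewrite oppr_le0; apply: fine_radon_ge0 => //.
    exact: Mpos.
by move: muC muB0; lra.
Qed.

(** Setwise convergence gives convergence on step functions by linearity; a uniform approximation of
    [f] then transfers it, since total masses are eventually bounded. *)
Lemma charge_integral_cvg (F : set_system RMb) nu (f : T -> R) :
  ProperFilter F -> F (@radon_positive R T) -> radon_positive nu ->
  (forall B, borel T B -> (fun mu : RMb => fine (mu B)) @ F --> fine (nu B)) ->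
  symmetrizable f ->
  (fun mu : RMb => charge_integral mu f) @ F --> charge_integral nu f.
Proof.
move=> FF Fpos pnu cvF sf.
have stepcvg g : step_function g ->
    (fun mu : RMb => charge_integral mu g) @ F --> charge_integral nu g.
  elim=> [|c A h mA sh IH].
    have ci0 (m : RMb) : charge_integral m (cst 0 : T -> R) = 0.
      by rewrite /charge_integral !Rintegral_cst// !mul0r subrr.
    by rewrite ci0; under eq_cvg do rewrite ci0; exact: cvg_cst.
  have bh := step_function_bounded_borel sh.
  rewrite charge_integralD//.
  under eq_cvg do rewrite charge_integralD//.
  by apply: cvgD => //; apply: cvgMr; exact: cvF.
have mT : borel T setT by exact: measurableT.
have bf := symmetrizable_bounded_borel sf.
apply/cvgrPdist_lt => e e0.
(* Total masses converge to that of [nu], so they eventually stay below [b]; replacing [f] by a step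
   function within [e / 3 / b] then costs at most [e / 3] for each measure. *)
pose b := fine (nu setT) + 1.
have nuT0 := fine_radon_ge0 pnu mT.
have b0 : 0 < b by rewrite /b; lra.
pose d := e / 3 / b.
have d0 : 0 < d by rewrite /d !divr_gt0.
have [g [sg fg]] := symmetrizable_approx sf d0.
have bg := step_function_bounded_borel sg.
have e30 : 0 < e / 3 by rewrite divr_gt0.
near=> mu.
have pmu : radon_positive mu by near: mu.
have muTb : fine (mu setT) <= b.
  apply/ltW; near: mu; apply: (cvgr_lt _ (cvF _ mT)); rewrite /b; lra.
have nug : `|charge_integral nu g - charge_integral mu g| < e / 3.
  by near: mu; apply: (cvgrPdist_lt _ _).1 => //; exact: stepcvg.
have dist (m : RMb) : radon_positive m -> fine (m setT) <= b ->
    `|charge_integral m f - charge_integral m g| <= e / 3.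
  move=> pm mb; apply: le_trans (charge_integral_dist_le pm bf bg fg) _.
  apply: (@le_trans _ _ (d * b)); first by rewrite ler_pM2l.
  by rewrite /d divfK// gt_eqF.
have := dist _ pmu muTb.
have /(dist _ pnu) : fine (nu setT) <= b by rewrite /b; lra.
move: nug; rewrite ltr_norml !ler_norml ltr_norml.
move=> /andP[? ?] /andP[? ?] /andP[? ?].
by apply/andP; split; lra.
Unshelve. all: by end_near. Qed.

(** Evaluations at compact sets are continuous and separate positive Radon measures. *)
Lemma closure_radon_hausdorff (M : set RMb) :
  (forall mu, M mu -> radon_positive mu) ->
  hausdorff_space (set_type (closure M)).
Proof.
move=> Mpos; apply: (@hausdorff_separating R) => x y xy; apply: val_inj.
have pos (z : set_type (closure M)) : radon_positive (set_val z).
  by apply: (closure_radon_positive Mpos); exact: set_valP.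
apply: radon_positive_eq (pos x) (pos y) _ => C cC.
apply: (xy (fun z => fine (set_val z C))) => z.
apply: (@continuous_comp _ _ _ set_val (fun mu : RMb => fine (mu C))).
  exact: initial_continuous.
exact: compact_continuous.
Qed.

Lemma tight_closure_compact (M : set RMb) (b : R) :
  (forall mu, M mu -> radon_positive mu) ->
  (forall mu, M mu -> fine (mu setT) <= b) ->
  (forall G e, open G -> 0 < e -> exists C, [/\ compact C, C `<=` G &
    forall mu, M mu -> fine (mu (G `\` C)) <= e]) ->
  compact (closure M).
Proof.
move=> Mpos Mb Mtight; rewrite compact_ultra => F FU FM.
have clpos := closure_radon_positive Mpos.
have mT : borel T setT by exact: measurableT.
have clb : forall mu, closure M mu -> fine (mu setT) <= b.
  apply: (@closure_le _ _ M (fun mu : RMb => fine (mu setT))) => //.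
  exact/open_continuous/openT.
have Fpos : F (@radon_positive R T) by apply: filterS FM.
(* Positivity and the mass bound confine the values to [[0, b]], so the ultrafilter has a limit on
   each Borel set; [0] is a dummy value elsewhere. *)
have /choice[l lP] : forall B, exists x : R,
    borel T B -> (fun mu : RMb => fine (mu B)) @ F --> x.
  move=> B; have [mB|nB] := pselect (borel T B); last by exists 0.
  have [|x [_ Fx]] :=
    @ultra_fmap_cvg _ _ F (fun mu => fine (mu B)) `[0, b]%classic
    FU (@segment_compact _ _ _).
    apply: filterS FM => mu Mmu /=.
    rewrite in_itv/= fine_radon_ge0//=; last exact: clpos.
    by apply: le_trans (clb _ Mmu); apply: fine_radon_le => //; exact: clpos.
  by exists x.
have l_ge0 B : borel T B -> 0 <= l B.
  move=> mB; apply: (cvgr_to_ge (lP B mB)).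
  by apply: filterS Fpos => mu pmu; exact: fine_radon_ge0.
have l_add A B : borel T A -> borel T B -> A `&` B = set0 ->
    l (A `|` B) = l A + l B.
  move=> mA mB AB; have mAB := measurableU _ _ mA mB.
  have := lP _ mAB.
  rewrite (_ : (fun _ => _) =
    (fun mu : RMb => fine (mu A)) \+ (fun mu : RMb => fine (mu B))).
    by move/(cvg_unique (@Rhausdorff R)); apply; apply: cvgD; exact: lP.
  by apply/funext => mu; rewrite fine_radonD.
have l_tight G e : open G -> 0 < e ->
    exists C, [/\ compact C, C `<=` G & l (G `\` C) <= e].
  (* As [G \ C] is open, its measure is weakly continuous, so the bound on [M] extends to the
     closure and then to the limit [l]. *)
  move=> oG e0; have [C [cC CG MC]] := Mtight _ _ oG e0.
  have oGC : open (G `\` C).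
    by apply: openI => //; rewrite openC; exact: compact_closed.
  exists C; split=> //; apply: (cvgr_to_le (lP _ (open_borel oGC))).
  apply: filterS FM; apply: closure_le => //; exact: open_continuous.
have [nu nuE] := content_radon_measure hT l_ge0 l_add l_tight.
have pnu : radon_positive nu by move=> B mB; rewrite nuE// lee_fin l_ge0.
have Fnu : F --> nu.
  move=> A [n [f [e [sf e0 fA]]]]; apply: filterS fA _.
  apply: filter_forall => k.
  have /cvgrPdist_lt/(_ _ e0) :
      (fun mu : RMb => charge_integral mu (f k)) @ F -->
      charge_integral nu (f k).
    apply: charge_integral_cvg => // B mB; rewrite nuE//=; exact: lP.
  by apply: filterS => mu; rewrite distrC.
exists nu; split=> //; rewrite [closure M](closure_id _).1;
  last exact: closed_closure.
by move=> U /Fnu FU'; exact: filter_ex (filterI FM FU').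
Qed.

(** The directed cover argument is phrased with the filter of compact subsets of [G] growing under
    inclusion, so that the near-covering form of compactness applies. *)
Lemma compact_closure_tight (M : set RMb) G e :
  (forall mu, M mu -> radon_positive mu) -> compact (closure M) ->
  open G -> 0 < e -> exists C, [/\ compact C, C `<=` G &
    forall mu, M mu -> fine (mu (G `\` C)) < e].
Proof.
move=> Mpos cM oG e0.
have mG := open_borel oG.
pose H C0 := [set C | [/\ compact C, C0 `<=` C & C `<=` G]].
pose F : set_system (set T) :=
  [set P | exists C0, [/\ compact C0, C0 `<=` G & H C0 `<=` P]].
have FF : Filter F.
  split=> [|P Q [C [cC CG CP]] [D [cD DG DQ]]|P Q PQ [C [cC CG CP]]].
  - by exists set0; split=> //; exact: compact0.
  - exists (C `|` D); split=> [||E [cE]].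
    + exact: compactU.
    + by move=> x [/CG|/DG].
    + rewrite subUset => -[CE DE] EG.
      by split; [exact: CP|exact: DQ].
  - by exists C; split=> //; exact: subset_trans CP PQ.
have [nu Mnu|C [cC CG CM]] := (compact_near_coveringP _).1 cM _ F
    (fun C mu => M mu -> fine (mu (G `\` C)) < e) FF; last first.
  (* The uniform bound holds for all compact sets between [C] and [G], hence for [C] itself. *)
  exists C; split=> // mu Mmu.
  by apply: (CM C) (subset_closure Mmu) Mmu; split.
have [C [cC CG nuC]] :=
  fine_radon_inner (closure_radon_positive Mpos Mnu) mG e0.
have oGC : open (G `\` C).
  by apply: openI => //; rewrite openC; exact: compact_closed.
exists ([set mu : RMb | fine (mu (G `\` C)) < e], H C) => /=.
  split; last by exists C; split.
  exact: (@cvgr_lt _ _ _ _ _ _ (open_continuous oGC (x := nu)) _ nuC).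
(* Enlarging [C] to [D] shrinks the difference with [G], and [mu] is monotone because it is
   positive. *)
move=> [mu D] /= [muC [cD CD DG]] Mmu; apply: le_lt_trans muC.
have mD := compact_borel hT cD.
apply: fine_radon_le (Mpos _ Mmu) _ (open_borel oGC) _.
  exact: (@measurableD _ (borel_type T)).
exact: setDS.
Qed.

End RadonMeasures.

Theorem theorem2 (R : realType) (T : ptopologicalType)
    (hT : hausdorff_space T)
    (M : set (radon_measure R T))
    (M0 : M !=set0)
    (Mpos : forall mu, M mu -> radon_positive mu) :
  (hausdorff_space (set_type (closure M)) /\
   compact [set: set_type (closure M)])
  <->
  ((forall (G : set T) (e : R), open G -> 0 < e ->
      exists C : set T, [/\ compact C, C `<=` G &
        forall mu, M mu -> (mu (G `\` C) < e%:E)%E]) /\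
   (ereal_sup [set mu [set: T] | mu in M] < +oo)%E).
Proof.
have mT : borel T setT by exact: measurableT.
have mGC (G C : set T) : open G -> compact C -> borel T (G `\` C).
  move=> oG cC; apply: (@measurableD _ (borel_type T)); first exact: open_borel.
  exact: compact_borel.
split=> [[_ /compact_set_type cM]|[tightM]].
  split=> [G e oG e0|].
    have [C [cC CG CM]] := compact_closure_tight hT Mpos cM oG e0.
    exists C; split=> // mu Mmu; rewrite -[X in (X < _)%E]fineK.
      by rewrite lte_fin; exact: CM.
    by apply: fin_num_measure; exact: mGC.
  (* Total mass is weakly continuous, so it is bounded on the compact closure. Only numbers strictly
     above [b] are known to be bounds, whence [b + 1]. *)
  have /compact_bounded[b [_ /(_ (b + 1))]] :
      compact [set fine ((mu : radon_measure R T) setT) | mu in closure M].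
    apply: continuous_compact cM; apply: continuous_subspaceT.
    exact: open_continuous openT.
  rewrite ltrDl ltr01 => /(_ isT) Mb.
  apply: (@le_lt_trans _ _ (b + 1)%:E); last exact: ltry.
  apply: ge_ereal_sup => _ [mu Mmu <-].
  rewrite -[X in (X <= _)%E]fineK ?fin_num_measure// lee_fin.
  apply: le_trans (ler_norm _) (Mb _ _).
  by exists mu => //; exact: subset_closure.
move=> Mfin; split; first exact: closure_radon_hausdorff.
apply/compact_set_type.
have supM mu : M mu -> (mu setT <= ereal_sup [set mu [set: T] | mu in M])%E.
  by move=> Mmu; apply: ereal_sup_ubound; exists mu.
apply: (@tight_closure_compact _ _ hT M
  (fine (ereal_sup [set mu [set: T] | mu in M]))) => // [mu Mmu|G e oG e0].
  apply: fine_le; [exact: fin_num_measure| |exact: supM].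
  (* The supremum is not [-oo], because it dominates the nonnegative mass of the member [mu]. *)
  rewrite fin_real// Mfin andbT; apply: lt_le_trans (supM _ Mmu).
  by apply: lt_le_trans (Mpos _ Mmu _ mT).
have [C [cC CG CM]] := tightM _ _ oG e0.
exists C; split=> // mu Mmu; rewrite -lee_fin fineK; first exact/ltW/CM.
by apply: fin_num_measure; exact: mGC.
Qed.
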